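(* There is a nonzero constant $c$, depending only on $m$, the dual torus $\widetilde T$, and orientation conventions, with the following property. Let $C$ be a special Lagrangian section of the semi-flat torus fibration $\pi:M\to B$ equipped with a flat $U(1)$ connection, and let $d\eta_1+i\,d\mu_1,\dots,d\eta_m+i\,d\mu_m$ be closed complex one-forms on $C$ representing infinitesimal variations of this A-cycle, where $\eta_l,\mu_l$ are real functions of $x$. Let $$\delta\mathcal A_l=i\sum_j\Big(\frac{\partial\eta_l}{\partial\widetilde x_j}\,d\widetilde x_j+\frac{\partial\mu_l}{\partial\widetilde x_j}\,d\widetilde y_j\Big),\qquad l=1,\dots,m,$$ be the corresponding infinitesimal variations, under the real Fourier-Mukai transform, of the mirror B-cycle on $W$. Assume boundary conditions such that the integrals defining the forms below converge absolutely. Then $${}_B\Omega(\delta\mathcal A_1,\dots,\delta\mathcal A_m)=c\cdot{}_A\Omega(d\eta_1+i\,d\mu_1,\dots,d\eta_m+i\,d\mu_m).$$ That is, the real Fourier-Mukai transform preserves, up to a universal constant, the natural $m$-forms on the moduli spaces of A-cycles and B-cycles.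
   Context: Semi-flat setting. $B\subset\mathbb R^m$ is an open ball with coordinates $x^1,\dots,x^m$, and $\phi:B\to\mathbb R$ is a smooth function with positive definite Hessian $\phi_{ij}=\partial^2\phi/\partial x^i\partial x^j$ satisfying the real Monge-Ampère equation $\det(\phi_{ij})=\mathrm{const}$. $M=B\times T$, where $T=\mathbb R^m/\Lambda$ is a torus ($\Lambda$ a lattice) with coordinates $y^1,\dots,y^m$, and $\pi:M\to B$ is the projection. $M$ has complex coordinates $z^j=x^j+iy^j$, Kähler form $\omega=\frac i2\sum\phi_{ij}\,dz^i\wedge d\bar z^j$, and holomorphic volume form $\Omega=dz^1\wedge\dots\wedge dz^m$. A section $C$ of $\pi$ is special Lagrangian if $\omega|_C=0$ and $\operatorname{Im}\Omega|_C=\tan\theta\operatorname{Re}\Omega|_C$ for some constant $\theta$. $C$ is identified with $B$ via $\pi$. The dual torus is $\widetilde T=\mathbb R^m/\Lambda^*$ with coordinates $\widetilde y_1,\dots,\widetilde y_m$, where $\Lambda^*=\{\widetilde y:\sum_j y^j\widetilde y_j\in2\pi\mathbb Z\ \text{for all } y\in\Lambda\}$. The mirror is $W=B\times\widetilde T$. Put $\widetilde x_j=\partial\phi/\partial x^j$, so $d\widetilde x_j=\sum_k\phi_{jk}dx^k$; these are coordinates on $B$. $W$ has complex coordinates $\widetilde z_j=\widetilde x_j+i\widetilde y_j$ and holomorphic volume form $\widetilde\Omega=d\widetilde z_1\wedge\dots\wedge d\widetilde z_m$. A-cycles and their transforms. A special Lagrangian section $y^j=\partial f/\partial\widetilde x_j$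 with flat $U(1)$ connection $d+i\,de$ is transformed to the $U(1)$ connection $d+i\sum_j\frac{\partial f}{\partial\widetilde x_j}d\widetilde y_j+i\sum_j\frac{\partial e}{\partial\widetilde x_j}d\widetilde x_j$ on $W$ (a B-cycle). Infinitesimal variations of an A-cycle are represented by complex harmonic (closed and co-closed, with respect to the metric induced on $C$) one-forms on $C$; write such a form as $d\eta+i\,d\mu$. In the variation $\delta\mathcal A$ in the claim, the $d\widetilde y_j$ terms come from varying $f$ by $\mu$ and the $d\widetilde x_j$ terms from varying $e$ by $\eta$. The form ${}_A\Omega$ on the moduli space of A-cycles is given on complex harmonic one-forms $\alpha_1,\dots,\alpha_m$ on $C$ by ${}_A\Omega(\alpha_1,\dots,\alpha_m)=\int_C\alpha_1\wedge\dots\wedge\alpha_m$. The form ${}_B\Omega$ is ${}_B\Omega=\int_W\widetilde\Omega\wedge\operatorname{Tr}\mathbb F^m$ on the space of connections on $W$, where $\mathbb F$ is the curvature of the universal connection; for $U(1)$ connections its value on tangent vectors $b_1,\dots,b_m$ (one-forms on $W$) is, up to a constant depending only on $m$, $\int_W\widetilde\Omega\wedge b_1\wedge\dots\wedge b_m$. *)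

(* Defs.v *)
From HB Require Import structures.
From mathcomp Require Import all_boot all_order all_algebra.
From mathcomp Require Import all_classical all_reals all_analysis.
From mathcomp Require Import complex.

Set Implicit Arguments.
Unset Strict Implicit.
Unset Printing Implicit Defensive.

Import Order.TTheory GRing.Theory Num.Theory.
Import numFieldNormedType.Exports.

Local Open Scope classical_set_scope.
Local Open Scope ring_scope.
Local Open Scope complex_scope.

(* Lebesgue measure on R^n, for the product sigma-algebra on n.-tuple R.      *)
Section lebesgue_tuple.
Context {R : realType}.
Local Open Scope ereal_scope.

Definition cons_pair n (p : R * n.-tuple R) : n.+1.-tuple R :=
  [tuple of p.1 :: p.2].

Fixpoint lebesgue_tuple n : set (n.-tuple R) -> \bar R :=
  match n with
  | 0%N => \d_([tuple] : 0.-tuple R)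
  | k.+1 => pushforward (@lebesgue_measure R \x @lebesgue_tuple k)
                        (@cons_pair k)
  end.

Definition uncons n (t : n.+1.-tuple R) : R * n.-tuple R :=
  (thead t, [tuple of behead t]).

Lemma cons_pairK n : cancel (@cons_pair n) (@uncons n).
Proof. by case=> x t; congr pair; apply/val_inj. Qed.

Lemma measurable_cons_pair n : measurable_fun setT (@cons_pair n).
Proof. exact: measurable_cons. Qed.

Lemma measurable_uncons n : measurable_fun setT (@uncons n).
Proof.
apply/measurable_fun_pairP; split.
  exact: measurable_tnth.
exact: measurable_behead.
Qed.

Section cons_measure.
Variable n : nat.
Variable lambda : {sigma_finite_measure set (measurableTypeR R) -> \bar R}.
Variable mu : {sigma_finite_measure set (n.-tuple R) -> \bar R}.
Local Notation prod := (lambda \x mu).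

Definition cons_measure := pushforward prod (@cons_pair n).
Local Notation nu := cons_measure.

Let nu0 : nu set0 = 0.
Proof. by rewrite /cons_measure /pushforward preimage_set0 measure0. Qed.

Let nu_ge0 A : 0 <= nu A.
Proof. by rewrite /cons_measure /pushforward; exact: measure_ge0. Qed.

Let nu_semi_sigma_additive : semi_sigma_additive nu.
Proof.
exact: (@measure_semi_sigma_additive _ _ _
  (measure_function_pushforward__canonical__measure_function_Measure
    prod (@measurable_cons_pair n))).
Qed.

HB.instance Definition _ :=
  isMeasure.Build _ _ _ nu nu0 nu_ge0 nu_semi_sigma_additive.

Let nu_sigma_finite : sigma_finite setT nu.
Proof.
have /sigma_finiteP[F [TF ndF Foo]] := sigma_finiteT lambda.
have /sigma_finiteP[G [TG ndG Goo]] := sigma_finiteT mu.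
exists (fun k => @uncons n @^-1` (F k `*` G k)).
  rewrite -preimage_bigcup -[LHS](preimage_setT (@uncons n)); congr preimage.
  apply/esym; rewrite -subTset => -[x y] _.
  have [i _ Fix] : (\bigcup_k F k) x by rewrite -TF.
  have [j _ Gjy] : (\bigcup_k G k) y by rewrite -TG.
  exists (maxn i j) => //; split.
    by move: (x) Fix; exact/subsetPset/ndF/leq_maxl.
  by move: (y) Gjy; exact/subsetPset/ndG/leq_maxr.
move=> k; have [mF Fk] := Foo k; have [mG Gk] := Goo k; split.
  rewrite -[X in measurable X]setTI; apply: measurable_uncons => //.
  exact: measurableX.
rewrite /cons_measure /pushforward -comp_preimage.
rewrite (_ : _ \o _ = id); last by apply/funext => p; exact: cons_pairK.
by rewrite preimage_id product_measure1E// lte_mul_pinfty// ge0_fin_numE.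
Qed.

HB.instance Definition _ :=
  Measure_isSigmaFinite.Build _ _ _ nu nu_sigma_finite.

Lemma cons_sigma_finite_measure :
  exists mu' : {sigma_finite_measure set (n.+1.-tuple R) -> \bar R}, nu = mu'.
Proof. by exists nu. Qed.

End cons_measure.

Lemma lebesgue_tuple_ex n :
  exists mu : {sigma_finite_measure set (n.-tuple R) -> \bar R},
    @lebesgue_tuple n = mu.
Proof.
elim: n => [|n [mu muE]]; first by exists \d_([tuple] : 0.-tuple R).
have [mu' mu'E] := cons_sigma_finite_measure lebesgue_measure mu.
by exists mu'; rewrite /= muE -mu'E.
Qed.

Section instances.
Variable n : nat.

Let lebesgue_tuple0 : @lebesgue_tuple n set0 = 0.
Proof. by have [mu ->] := lebesgue_tuple_ex n. Qed.

Let lebesgue_tuple_ge0 A : 0 <= @lebesgue_tuple n A.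
Proof. by have [mu ->] := lebesgue_tuple_ex n. Qed.

Let lebesgue_tuple_additive : semi_sigma_additive (@lebesgue_tuple n).
Proof.
by have [mu ->] := lebesgue_tuple_ex n; exact: measure_semi_sigma_additive.
Qed.

HB.instance Definition _ := isMeasure.Build _ _ _ (@lebesgue_tuple n)
  lebesgue_tuple0 lebesgue_tuple_ge0 lebesgue_tuple_additive.

Let lebesgue_tuple_sigma_finite : sigma_finite setT (@lebesgue_tuple n).
Proof. by have [mu ->] := lebesgue_tuple_ex n; exact: sigma_finiteT. Qed.

HB.instance Definition _ := Measure_isSigmaFinite.Build _ _ _
  (@lebesgue_tuple n) lebesgue_tuple_sigma_finite.

End instances.
End lebesgue_tuple.

Section complex_integral.
Context d (T : measurableType d) (R : realType).
Variable mu : {measure set T -> \bar R}.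

Definition cintegrable (D : set T) (h : T -> R[i]) :=
  mu.-integrable D (EFin \o (fun t => complex.Re (h t))) /\
  mu.-integrable D (EFin \o (fun t => complex.Im (h t))).

Definition cintegral (D : set T) (h : T -> R[i]) : R[i] :=
  Rintegral mu D (fun t => complex.Re (h t)) +i*
  Rintegral mu D (fun t => complex.Im (h t)).

End complex_integral.

(* Derivative at 0 of a complex-valued function of a real variable.           *)
Definition cderive0 (R : realType) (h : R -> R[i]) : R[i] :=
  derive1 (fun t : R => complex.Re (h t)) 0 +i*
  derive1 (fun t : R => complex.Im (h t)) 0.

(* Complex-valued exterior forms on a real vector space V, of all degrees at  *)
(* once: a k-form is a function on sequences of vectors vanishing on the      *)
(* sequences whose length is not k.                                           *)
Section exterior.
Context {R : realType} {V : Type}.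
Local Notation C := R[i].
Definition form := seq V -> C.

Definition form0 : form := fun vs => if vs is [::] then 1 else 0.
Definition form1 (a : V -> C) : form :=
  fun vs => if vs is [:: v] then a v else 0.
Definition form2 (a : V -> V -> C) : form :=
  fun vs => if vs is [:: u; v] then a u v else 0.

(* The shuffle moving the entries selected by k to the front has sign         *)
(* (-1) ^+ inversions k.                                                      *)
Definition inversions n (k : n.-tuple bool) : nat :=
  #|[pred ij : 'I_n * 'I_n |
      [&& (ij.1 < ij.2)%N, ~~ tnth k ij.1 & tnth k ij.2]]|.

(* The sum over (p, q)-shuffles; for covectors a and b it gives               *)
(* (a /\ b)(u, v) = a u * b v - a v * b u.                                    *)
Definition wedge (a b : form) : form := fun vs =>
  \sum_(k : (size vs).-tuple bool)
    (-1) ^+ inversions k * a (mask k vs) * b (mask (map negb k) vs).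

Definition wedges (s : seq form) : form := foldr wedge form0 s.
Definition wedge_pow (a : form) (n : nat) : form := wedges (nseq n a).

End exterior.
Arguments form : clear implicits.

Definition pullback (R : realType) (V W : Type) (h : V -> W) (a : form R W) :
  form R V := fun vs => a (map h vs).

Section calculus.
Context {R : realType} {m : nat}.
Local Notation pt := 'rV[R]_m.

Definition basis_vec (j : 'I_m) : pt := delta_mx 0 j.

Definition partial (j : 'I_m) (f : pt -> R) : pt -> R :=
  fun x => 'D_(basis_vec j) f x.

(* C^infinity on an open set B: all iterated partial derivatives are          *)
(* differentiable at the points of B.                                         *)
Definition smooth_on (B : set pt) (f : pt -> R) :=
  forall (s : seq 'I_m) (x : pt), B x -> differentiable (foldr partial f s) x.

(* The library norm on row vectors is the sup norm, hence the explicit sum.   *)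
Definition open_ball (B : set pt) :=
  exists (a : pt) (r : R), 0 < r /\
    B = [set x | \sum_j (x 0 j - a 0 j) ^+ 2 < r ^+ 2].

Definition hessian (phi : pt -> R) (x : pt) : 'M[R]_m :=
  \matrix_(i, j) partial i (partial j phi) x.

Definition posdef (H : 'M[R]_m) :=
  forall v : pt, v != 0 -> 0 < (v *m H *m v^T) 0 0.

Definition semi_flat (B : set pt) (phi : pt -> R) :=
  [/\ open_ball B,
      smooth_on B phi,
      forall x, B x -> posdef (hessian phi x)
    & exists k : R, forall x, B x -> \det (hessian phi x) = k].

End calculus.

(* Lattices and tori.  A torus R^m / L is handled through its universal cover *)
(* R^m: functions on it are L-periodic functions, and they are integrated     *)
(* over a fundamental parallelotope.                                          *)
Section lattice.
Context {R : realType} {m : nat}.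
Local Notation pt := 'rV[R]_m.

Definition lattice_basis (L : set pt) (G : 'M[R]_m) :=
  G \in unitmx /\
  L = [set map_mx intr k *m G | k in [set: 'rV[int]_m]].

Definition is_lattice (L : set pt) := exists G, lattice_basis L G.

Definition dual_lattice (L : set pt) : set pt :=
  [set yt | forall y, L y ->
     exists k : int, \sum_j y 0 j * yt 0 j = 2 * pi * k%:~R].

Definition fundamental_domain (L : set pt) : set pt :=
  [set t *m xget 1%:M [set G | lattice_basis L G]
    | t in [set t : pt | forall j, 0 <= t 0 j < 1]].

End lattice.

(* The total spaces M = B x T and W = B x T~ have the trivialised tangent     *)
(* space R^m x R^m, the second factor being tangent to the torus.             *)
Section semiflat.
Context {R : realType} {m : nat}.
Local Notation C := R[i].
Local Notation pt := 'rV[R]_m.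
Local Notation tot := ('rV[R]_m * 'rV[R]_m)%type.
Variables (B : set pt) (phi : pt -> R).

Definition dz (j : 'I_m) (v : tot) : C := v.1 0 j +i* v.2 0 j.
Definition dzbar (j : 'I_m) (v : tot) : C := v.1 0 j -i* v.2 0 j.

Definition omega (x : pt) : form R tot := fun vs =>
  \sum_i \sum_j 'i%C / 2 * (hessian phi x i j)%:C *
    wedge (form1 (dz i)) (form1 (dzbar j)) vs.

Definition Omega : form R tot := wedges [seq form1 (dz j) | j <- enum 'I_m].

(* Tangent map of x |-> (x, s x), which identifies B with the section C.      *)
Definition section_push (s : pt -> pt) (x : pt) (v : pt) : tot :=
  (v, 'd s x v).

Definition special_lagrangian (s : pt -> pt) :=
  (forall x, B x -> forall vs, pullback (section_push s x) (omega x) vs = 0) /\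
  exists theta : R, cos theta != 0 /\
    forall x, B x -> forall vs,
      complex.Im (pullback (section_push s x) Omega vs) =
      tan theta * complex.Re (pullback (section_push s x) Omega vs).

Definition cplx_structure (v : tot) : tot := (- v.2, v.1).
Definition kaehler_metric (x : pt) (u v : tot) : R :=
  complex.Re (omega x [:: u; cplx_structure v]).

Definition induced_metric (s : pt -> pt) (x : pt) : 'M[R]_m :=
  \matrix_(k, l) kaehler_metric x (section_push s x (basis_vec k))
                                  (section_push s x (basis_vec l)).

Definition closed_form (b : pt -> pt -> R) :=
  forall x, B x -> forall k l,
    partial k (b ^~ (basis_vec l)) x = partial l (b ^~ (basis_vec k)) x.

(* d^* b = - det(g)^(-1/2) sum_kl d_k (det(g)^(1/2) g^kl b_l).                *)
Definition coclosed_form (s : pt -> pt) (b : pt -> pt -> R) :=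
  forall x, B x ->
    \sum_k partial k (fun q => Num.sqrt (\det (induced_metric s q)) *
      \sum_l invmx (induced_metric s q) k l * b q (basis_vec l)) x = 0.

Definition harmonic_form (s : pt -> pt) (a : pt -> pt -> C) :=
  [/\ closed_form (fun x v => complex.Re (a x v)),
      closed_form (fun x v => complex.Im (a x v)),
      coclosed_form s (fun x v => complex.Re (a x v))
    & coclosed_form s (fun x v => complex.Im (a x v))].

(* The one-form d eta + i d mu on C, pulled back to B.                        *)
Definition A_variation (eta mu : pt -> R) (x : pt) (v : pt) : C :=
  'd eta x v +i* 'd mu x v.

(* The coordinates xt_j = d phi / d x^j on B, the coordinate vector fields    *)
(* d / d xt_j (the frame dual to the d xt_j) and the derivations they define. *)
Definition xt (j : 'I_m) : pt -> R := partial j phi.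
Definition xt_field (j : 'I_m) (x : pt) : pt := row j (invmx (hessian phi x)).
Definition partial_xt (j : 'I_m) (f : pt -> R) (x : pt) : R :=
  'D_(xt_field j x) f x.

Definition grad_section (f : pt -> R) (x : pt) : pt := \row_j partial_xt j f x.

(* Points of W are pairs (x, yt), with yt in the universal cover of T~.       *)
Definition dxt (j : 'I_m) (p v : tot) : R := 'd (xt j) (p.1) (v.1).
Definition dyt (j : 'I_m) (v : tot) : R := v.2 0 j.
Definition dzt (j : 'I_m) (p v : tot) : C := dxt j p v +i* dyt j v.
Definition Omegat (p : tot) : form R tot :=
  wedges [seq form1 (dzt j p) | j <- enum 'I_m].

(* One-forms on W; the U(1) connection d + a is represented by a.             *)
Definition oneform := tot -> tot -> C.

(* Transform of the section xt-gradient of f with the flat connection         *)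
(* d + i de.  It is linear in (e, f), so that varying e by eta and f by mu    *)
(* varies it by fourier_mukai eta mu.                                         *)
Definition fourier_mukai (e f : pt -> R) : oneform := fun p v =>
  'i%C * \sum_j (partial_xt j e p.1 * dxt j p v +
               partial_xt j f p.1 * dyt j v)%:C.

(* The universal connection on (space of connections) x W is, at (a, p), the  *)
(* one-form (b, v) |-> a_p(v); its curvature is the exterior derivative.      *)
Definition univ_connection (q u : oneform * tot) : C := q.1 q.2 u.2.

Definition move (q u : oneform * tot) (t : R) : oneform * tot :=
  (fun p v => q.1 p v + t%:C * u.1 p v, q.2 + t *: u.2).

Definition univ_curvature (q u v : oneform * tot) : C :=
  cderive0 (fun t => univ_connection (move q u t) v) -
  cderive0 (fun t => univ_connection (move q v t) u).

(* The integrand of B_Omega at the connection a on the tangent vectors b_l:   *)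
(* the 3m-form Omegat /\ F^m contracted with b_1, ..., b_m and evaluated on   *)
(* the frame d/dx^1, ..., d/dx^m, d/dyt_1, ..., d/dyt_m of W.                 *)
Definition B_integrand (a : oneform) (b : 'I_m -> oneform) (p : tot) : C :=
  wedge (pullback snd (Omegat p))
        (wedge_pow (form2 (univ_curvature (a, p))) m)
    ([seq (b l, 0) | l <- enum 'I_m] ++
     [seq (fun _ _ => 0, (basis_vec j, 0)) | j <- enum 'I_m] ++
     [seq (fun _ _ => 0, (0, basis_vec j)) | j <- enum 'I_m]).

Definition A_integrand (a : 'I_m -> pt -> pt -> C) (x : pt) : C :=
  wedges [seq form1 (a l x) | l <- enum 'I_m]
         [seq basis_vec j | j <- enum 'I_m].

Definition row_of (t : m.-tuple R) : pt := \row_j tnth t j.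

Definition A_domain : set (m.-tuple R) := row_of @^-1` B.
Definition B_domain (Lt : set pt) : set (m.-tuple R * m.-tuple R) :=
  A_domain `*` (row_of @^-1` fundamental_domain Lt).

Definition A_convergent (a : 'I_m -> pt -> pt -> C) :=
  cintegrable (@lebesgue_tuple R m) A_domain
    (fun t => A_integrand a (row_of t)).

Definition B_convergent (Lt : set pt) (a : oneform) (b : 'I_m -> oneform) :=
  cintegrable (@lebesgue_tuple R m \x @lebesgue_tuple R m)%E (B_domain Lt)
    (fun t => B_integrand a b (row_of t.1, row_of t.2)).

(* The booleans orC and orW are the orientations of C and W: false for the    *)
(* one in which dx^1 ... dx^m, resp. dx^1 ... dx^m dyt_1 ... dyt_m, is        *)
(* positive, true for the opposite one.                                       *)
Definition A_Omega (orC : bool) (a : 'I_m -> pt -> pt -> C) : C :=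
  (-1) ^+ orC * cintegral (@lebesgue_tuple R m) A_domain
    (fun t => A_integrand a (row_of t)).

Definition B_Omega (orW : bool) (Lt : set pt)
    (a : oneform) (b : 'I_m -> oneform) : C :=
  (-1) ^+ orW *
  cintegral (@lebesgue_tuple R m \x @lebesgue_tuple R m)%E (B_domain Lt)
    (fun t => B_integrand a b (row_of t.1, row_of t.2)).

End semiflat.

(* Main.v *)
Require Import Defs.
From mathcomp Require Import all_boot all_order all_algebra.
From mathcomp Require Import all_classical all_reals all_analysis.
From mathcomp Require Import measurable_realfun complex.
From mathcomp Require Import ring lra zify.
Import Order.TTheory GRing.Theory Num.Theory.
Import numFieldNormedType.Exports.
Local Open Scope classical_set_scope.
Local Open Scope ring_scope.
Local Open Scope complex_scope.

(** The two integrands are proportional at every point, with a real factor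
    that depends only on m; the theorem follows by integrating over the fibre.

    The tangent vectors b_1, ..., b_m to the space of connections are first
    contracted out of Omegat /\ F^m, F being the curvature of the universal
    connection.  They annihilate Omegat, F vanishes on pairs of them, and
    F(b_l, v) = b_l(v) for v tangent to W.  As contraction is an antiderivation
    of the wedge product ([wedge_cons]) and two-forms are central
    ([form2_wedgeC]), each contraction trades one factor F for the one-form b_l
    ([wedge_wedge_pow_cat]); the curvature of the connection on W itself never
    contributes.  There remains, up to a sign, m! times
    Omegat /\ b_1 /\ ... /\ b_m ([B_integrand_wedges]).

    On a frame, a product of one-forms is a determinant ([wedges_det]).  In the
    frame d/dx, d/dyt of W the rows dzt_j = dxt_j + i dyt_j form the blocks
    (A, i) and the rows b_l = i sum_j (N_lj dxt_j + M_lj dyt_j) the blocks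
    (i N A, i M), where A is the Jacobian matrix of xt.  Subtracting M times the
    first rows from the second ones, that is, reducing modulo dzt, turns the
    latter into (i (N + i M) A, 0), so the determinant is det((N + i M) A)
    ([det_block_i]).  By the chain rule ([differential_xt]), where positivity of
    the Hessian makes the xt_j coordinates, (N + i M) A is the matrix of
    the forms d eta_l + i d mu_l in the coordinates x, whose determinant is the
    integrand of A_Omega ([B_integrandE]).

    The integrand on W is thus constant along the fibres, and Fubini's theorem
    ([cintegral_prod_fst]) yields the volume of a fundamental parallelotope of
    the dual lattice as a further factor; it is positive and finite because the
    parallelotope contains a cube and lies in another one
    ([lebesgue_fundamental_domain]). *)

(** * The algebra of exterior forms *)

Section contraction.
Context {R : realType} {V : Type}.
Implicit Types (a b c : Defs.form R V) (vs : seq V).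

(** Interior product with the vector u, inserted in first position. *)
Definition contract (u : V) a : Defs.form R V := fun vs => a (u :: vs).

(** The grading involution, acting on k-forms as (-1)^k. *)
Definition grade_sign a : Defs.form R V := fun vs => (-1) ^+ size vs * a vs.

Lemma inversionsE n (k : n.-tuple bool) :
  inversions k =
  (\sum_(i < n) \sum_(j < n) [&& (i < j)%N, ~~ tnth k i & tnth k j])%N.
Proof.
rewrite /inversions -sum1_card pair_big /= big_mkcond /=.
by apply: eq_bigr => -[i j] _; rewrite !inE /=; case: andP.
Qed.

Lemma inversions_cons n (x : bool) (k : n.-tuple bool) :
  inversions [tuple of x :: k] = (~~ x * count id k + inversions k)%N.
Proof.
rewrite !inversionsE big_ord_recl; congr addn.
  rewrite big_ord_recl/= add0n -sum1_count big_tuple big_distrr [RHS]big_mkcond.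
  by apply: eq_bigr => j _; rewrite tnth0 tnthS; case: x; case: (tnth k j).
apply: eq_bigr => i _; rewrite big_ord_recl /= add0n.
by apply: eq_bigr => j _; rewrite !tnthS.
Qed.

Lemma wedge_nil a b : wedge a b [::] = a [::] * b [::].
Proof.
rewrite /wedge (bigD1 [tuple]) //= big1 ?addr0 => [|k /eqP[]]; last first.
  by rewrite (tuple0 k).
rewrite (_ : inversions _ = 0)%N ?expr0 ?mul1r //.
by rewrite inversionsE big_ord0.
Qed.

(** Contraction is an antiderivation: a shuffle of u :: vs sends u either to the
    first factor, or to the second one past all the arguments of the first.
    Together with [wedge_nil] this determines the wedge product. *)
Lemma wedge_cons a b u vs :
  wedge a b (u :: vs) =
  wedge (contract u a) b vs + wedge (grade_sign a) (contract u b) vs.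
Proof.
rewrite /wedge /=.
pose g (p : bool * (size vs).-tuple bool) : (size vs).+1.-tuple bool :=
  [tuple of p.1 :: p.2].
pose h (k : (size vs).+1.-tuple bool) := (thead k, [tuple of behead k]).
rewrite (reindex g) /=; last first.
  exists h => [[x t]|k] _; rewrite /g /h /=; first by congr pair; exact/val_inj.
  by case/tupleP: k => x t; apply/val_inj.
rewrite -(pair_bigA _ (fun x t => (-1) ^+ inversions (g (x, t)) *
  a (mask (g (x, t)) (u :: vs)) * b (mask (map negb (g (x, t))) (u :: vs)))) /=.
rewrite big_bool /=; congr (_ + _); apply: eq_bigr => k _.
  by rewrite inversions_cons.
rewrite inversions_cons mul1n exprD /grade_sign size_mask ?size_tuple //.
by rewrite /contract !mulrA; congr (_ * _ * _); rewrite mulrC.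
Qed.

Lemma eq_form a b : (forall vs, a vs = b vs) -> a = b.
Proof. by move=> ab; apply/funext. Qed.

Lemma contract_wedge u a b : contract u (wedge a b) =
  fun vs => wedge (contract u a) b vs + wedge (grade_sign a) (contract u b) vs.
Proof. by apply: eq_form => vs; rewrite -wedge_cons. Qed.

Lemma wedgeDl a b c vs :
  wedge (fun ws => a ws + b ws) c vs = wedge a c vs + wedge b c vs.
Proof.
by rewrite /wedge -big_split; apply: eq_bigr => k _ /=; rewrite mulrDr mulrDl.
Qed.

Lemma wedgeDr a b c vs :
  wedge a (fun ws => b ws + c ws) vs = wedge a b vs + wedge a c vs.
Proof.
by rewrite /wedge -big_split; apply: eq_bigr => k _ /=; rewrite mulrDr.
Qed.

Lemma wedgeZl x a b vs : wedge (fun ws => x * a ws) b vs = x * wedge a b vs.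
Proof.
rewrite /wedge mulr_sumr; apply: eq_bigr => k _.
by rewrite !mulrA; do 2!congr (_ * _); rewrite mulrC.
Qed.

Lemma wedgeZr x a b vs : wedge a (fun ws => x * b ws) vs = x * wedge a b vs.
Proof.
rewrite /wedge mulr_sumr; apply: eq_bigr => k _.
by rewrite mulrCA mulrA.
Qed.

Lemma wedge0l b vs : wedge (fun _ => 0) b vs = 0.
Proof. by rewrite /wedge big1 // => k _; rewrite mulr0 mul0r. Qed.

Lemma wedge0r a vs : wedge a (fun _ => 0) vs = 0.
Proof. by rewrite /wedge big1 // => k _; rewrite mulr0. Qed.

Lemma grade_signK a : grade_sign (grade_sign a) = a.
Proof.
by apply: eq_form => vs; rewrite /grade_sign mulrA -expr2 sqrr_sign mul1r.
Qed.

Lemma grade_sign_wedge a b :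
  grade_sign (wedge a b) = wedge (grade_sign a) (grade_sign b).
Proof.
apply: eq_form => vs; rewrite /grade_sign /wedge mulr_sumr.
apply: eq_bigr => k _.
have szE : size vs = (size (mask k vs) + size (mask (map negb k) vs))%N.
  rewrite !size_mask ?size_map ?size_tuple // count_map.
  by rewrite -[LHS](size_tuple k) -(count_predC id k).
have -> : (-1) ^+ size vs = (-1) ^+ size (mask k vs) *
    (-1) ^+ size (mask (map negb k) vs) :> R[i] by rewrite -exprD -szE.
ring.
Qed.

Lemma contract_grade_sign u a :
  contract u (grade_sign a) = fun vs => - grade_sign (contract u a) vs.
Proof.
by apply: eq_form => vs; rewrite /contract /grade_sign /= exprS mulN1r mulNr.
Qed.

Lemma contract_form0 u : contract u form0 = fun=> 0 :> R[i].
Proof. by []. Qed.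

Lemma grade_sign_form0 : grade_sign form0 = form0.
Proof. by apply: eq_form => -[|u vs]; rewrite /grade_sign /= ?mulr1 ?mulr0. Qed.

Lemma wedge1f a : wedge form0 a = a.
Proof.
apply: eq_form => vs; elim: vs a => [|u vs IH] a.
  by rewrite wedge_nil mul1r.
by rewrite wedge_cons contract_form0 wedge0l grade_sign_form0 IH add0r.
Qed.

Lemma wedgef1 a : wedge a form0 = a.
Proof.
apply: eq_form => vs; elim: vs a => [|u vs IH] a.
  by rewrite wedge_nil mulr1.
by rewrite wedge_cons contract_form0 wedge0r IH addr0.
Qed.

Lemma wedgeA a b c : wedge a (wedge b c) = wedge (wedge a b) c.
Proof.
apply: eq_form => vs; elim: vs a b c => [|u vs IH] a b c.
  by rewrite !wedge_nil mulrA.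
rewrite !wedge_cons !contract_wedge wedgeDl wedgeDr IH grade_sign_wedge.
by rewrite !IH addrA.
Qed.

Lemma wedges_cat (s t : seq (Defs.form R V)) :
  wedges (s ++ t) = wedge (wedges s) (wedges t).
Proof. by elim: s => [|a s IH] /=; rewrite ?wedge1f // IH wedgeA. Qed.

Lemma wedge_powS a n : wedge_pow a n.+1 = wedge a (wedge_pow a n).
Proof. by []. Qed.

Lemma contract_form1 u (al : V -> R[i]) :
  contract u (form1 al) = fun vs => al u * form0 vs.
Proof. by apply: eq_form => -[|? ?] /=; rewrite /contract /= ?mulr1 ?mulr0. Qed.

Lemma grade_sign_form1 (al : V -> R[i]) :
  grade_sign (form1 al) = fun vs => -1 * form1 al vs.
Proof.
apply: eq_form => -[|v [|w vs]]; rewrite /grade_sign /= ?mulr0 //.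
Qed.

Lemma contract_form2 u (F : V -> V -> R[i]) :
  contract u (form2 F) = form1 (F u).
Proof. by apply: eq_form => -[|? [|? ?]]. Qed.

Lemma grade_sign_form2 (F : V -> V -> R[i]) : grade_sign (form2 F) = form2 F.
Proof.
apply: eq_form => -[|u [|v [|w vs]]]; rewrite /grade_sign /= ?mulr0 //.
by rewrite -signr_odd mul1r.
Qed.

Lemma form1_wedgeC (al : V -> R[i]) b :
  wedge (form1 al) b = wedge (grade_sign b) (form1 al).
Proof.
apply: eq_form => vs; elim: vs b => [|u vs IH] b.
  by rewrite !wedge_nil /= mul0r mulr0.
rewrite !wedge_cons grade_signK contract_form1 wedgeZl wedge1f wedgeZr wedgef1.
rewrite addrC grade_sign_form1 wedgeZl IH contract_grade_sign.
congr (_ + _).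
by rewrite -wedgeZl; congr (wedge _ _ _); apply: eq_form => ws; rewrite mulN1r.
Qed.

(** Neither factor need be alternating: the shuffle product of arbitrary forms
    is already graded-commutative. *)
Lemma form2_wedgeC (F : V -> V -> R[i]) b :
  wedge (form2 F) b = wedge b (form2 F).
Proof.
apply: eq_form => vs; elim: vs b => [|u vs IH] b.
  by rewrite !wedge_nil /= mul0r mulr0.
rewrite !wedge_cons grade_sign_form2 contract_form2 form1_wedgeC IH.
by rewrite addrC.
Qed.

Lemma contract_wedge_pow u (F : V -> V -> R[i]) n :
  contract u (wedge_pow (form2 F) n.+1) =
  fun vs => n.+1%:R * wedge (form1 (F u)) (wedge_pow (form2 F) n) vs.
Proof.
elim: n => [|n IH]; rewrite wedge_powS contract_wedge contract_form2.
  by apply: eq_form => vs; rewrite wedge0r addr0 mul1r.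
rewrite grade_sign_form2 IH; apply: eq_form => vs.
rewrite wedgeZr !wedgeA form2_wedgeC -!wedgeA -wedge_powS.
by rewrite -[in RHS]natr1 mulrDl mul1r addrC.
Qed.

End contraction.

(** * Evaluation on frames *)

(** The two block rows are those of the (1,0)-forms dzt_j and of the variations
    in the frame d/dx, d/dyt. *)
Lemma det_block_i {K : comNzRingType} n (i : K) (A N M : 'M[K]_n) :
  i * i = -1 ->
  \det (block_mx A i%:M (i *: (N *m A)) (i *: M)) = \det ((N + i *: M) *m A).
Proof.
move=> ii; set X := block_mx _ _ _ _.
(* L subtracts M times the first block row from the second one; P swaps the
   block columns. *)
pose L : 'M[K]_(n + n) := block_mx 1%:M 0 (- M) 1%:M.
pose P : 'M[K]_(n + n) := block_mx 0 1%:M 1%:M 0.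
have detL : \det L = 1 by rewrite det_lblock !det1 mulr1.
have detP : \det P = (-1) ^+ n.
  have : block_mx 1%:M 0 (- 1%:M) 1%:M *m (block_mx 1%:M 1%:M 0 1%:M *m P) =
         block_mx 1%:M 1%:M 0 (- 1%:M) :> 'M[K]_(n + n).
    by rewrite !mulmx_block !(mul1mx, mul0mx, mulNmx, mulmx1, mulmx0, addr0,
      add0r, oppr0) addNr.
  move/(congr1 determinant); rewrite !det_mulmx det_lblock !det_ublock !det1.
  by rewrite !mul1r -scaleN1r detZ det1 mulr1.
have : L *m X *m P = block_mx i%:M A 0 (i *: ((N + i *: M) *m A)).
  rewrite !mulmx_block !(mulmx1, mul1mx, mul0mx, mulmx0, addr0, add0r).
  congr block_mx.
    by rewrite mul_mx_scalar scalerN addNr.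
  by rewrite mulmxDl scalerDr -scalemxAl scalerA ii scaleN1r addrC mulNmx.
move/(congr1 determinant).
rewrite !det_mulmx detL mul1r detP det_ublock det_scalar detZ mulrA.
rewrite -exprMn ii mulrC => /(can_inj (signrMK _)).
by rewrite det_mulmx.
Qed.

Section evaluation.
Context {R : realType}.

Lemma pullback_wedge {V W : Type} (h : V -> W) (a b : Defs.form R W) :
  pullback h (wedge a b) = wedge (pullback h a) (pullback h b).
Proof.
apply: eq_form => vs; rewrite /pullback.
elim: vs a b => [|v vs IH] a b /=; first by rewrite !wedge_nil.
rewrite !wedge_cons !IH; congr (_ + wedge _ _ _).
by apply: eq_form => ws; rewrite /grade_sign size_map.
Qed.

Lemma pullback_wedges1 {V W I : Type} (h : V -> W) (al : I -> W -> R[i])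
    (s : seq I) :
  pullback h (wedges [seq form1 (al i) | i <- s]) =
  wedges [seq form1 (fun v => al i (h v)) | i <- s].
Proof.
elim: s => [|i s IH] /=; first by apply: eq_form => -[].
by rewrite pullback_wedge IH; congr wedge; apply: eq_form => -[|v []].
Qed.

Context {V : Type}.

Lemma grade_sign_wedges1 {I : Type} (al : I -> V -> R[i]) (s : seq I) :
  grade_sign (wedges [seq form1 (al i) | i <- s]) =
  fun vs => (-1) ^+ size s * wedges [seq form1 (al i) | i <- s] vs.
Proof.
elim: s => [|i s IH] /=.
  by rewrite grade_sign_form0; apply: eq_form => vs; rewrite mul1r.
rewrite grade_sign_wedge grade_sign_form1 IH; apply: eq_form => vs.
by rewrite wedgeZl wedgeZr mulrA -exprS.
Qed.

Lemma contract_wedges1_eq0 {I : Type} (al : I -> V -> R[i]) (s : seq I) u :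
  (forall i, al i u = 0) ->
  contract u (wedges [seq form1 (al i) | i <- s]) = fun=> 0.
Proof.
move=> al0; elim: s => [|i s IH] //=.
apply: eq_form => vs; rewrite contract_wedge IH wedge0r contract_form1 al0.
by rewrite wedgeZl mul0r add0r.
Qed.

(** Contracting n vectors out of a /\ F^n, when these vectors annihilate the
    form a, homogeneous of degree d, and F vanishes on pairs of them.  Each of
    them picks one of the remaining factors F, hence n!; the sign comes from
    moving it past the d arguments of a and past the one-forms already
    produced. *)
Lemma wedge_wedge_pow_cat {I : Type} (F : V -> V -> R[i]) (u : I -> V)
    (a : Defs.form R V) d (s : seq I) ws :
    (forall i j, F (u i) (u j) = 0) ->
    (forall i, contract (u i) a = fun=> 0) ->
    grade_sign a = (fun vs => (-1) ^+ d * a vs) ->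
  wedge a (wedge_pow (form2 F) (size s)) ([seq u i | i <- s] ++ ws) =
  (-1) ^+ (d * size s + 'C(size s, 2)) * (size s)`!%:R *
    wedge a (wedges [seq form1 (F (u i)) | i <- s]) ws.
Proof.
move=> F0; elim: s a d => [|i s IH] a d a0 da.
  by rewrite /= muln0 !mul1r.
rewrite [size _]/= [map _ _]/= cat_cons wedge_cons a0 wedge0l add0r.
(* The new one-form is absorbed into a, whose degree becomes d + 1. *)
rewrite contract_wedge_pow wedgeZr da wedgeZl wedgeA (IH _ d.+1).
- rewrite /= -wedgeA binS bin1 factS natrM.
  rewrite (_ : d * _ + _ = d + (d.+1 * size s + 'C(size s, 2)))%N; last by lia.
  rewrite (exprD _ d) (exprD _ (_ * _)%N) !mulrA; congr (_ * _).
  move: (_ ^+ d) (_ ^+ (d.+1 * _)%N) (_ ^+ 'C(_, _)) (_`!%:R) => x y z t.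
  by ring.
- move=> j; rewrite contract_wedge a0 contract_form1 F0; apply: eq_form => vs.
  by rewrite wedge0l wedgeZr mul0r addr0.
rewrite grade_sign_wedge da grade_sign_form1; apply: eq_form => vs.
by rewrite wedgeZl wedgeZr mulrA -exprSr.
Qed.

(** The shuffles of signature (1, n): Laplace expansion along a row. *)
Lemma wedge_form1 n (al : V -> R[i]) (a : Defs.form R V) (v : 'I_n.+1 -> V) :
  wedge (form1 al) a [seq v j | j <- enum 'I_n.+1] =
  \sum_(j < n.+1) (-1) ^+ j * al (v j) * a [seq v (lift j k) | k <- enum 'I_n].
Proof.
elim: n a v => [|n IH] a v; rewrite enum_ordSl /= wedge_cons contract_form1
  wedgeZl wedge1f grade_sign_form1 wedgeZl big_ord_recl mul1r.
  by rewrite enum_ord0 /= wedge_nil big_ord0 /= mul0r mulr0.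
rewrite -map_comp IH mulr_sumr; congr (_ + _); apply: eq_bigr => j _.
rewrite !mulrA -exprS /contract [in RHS]enum_ordSl /= -map_comp.
congr (_ * a (v _ :: _)); first exact/val_inj.
by apply: eq_map => k /=; congr v; apply/val_inj; rewrite /= !bumpS.
Qed.

Lemma wedges_det n (al : 'I_n -> V -> R[i]) (v : 'I_n -> V) :
  wedges [seq form1 (al i) | i <- enum 'I_n] [seq v j | j <- enum 'I_n] =
  \det (\matrix_(i, j) al i (v j)).
Proof.
elim: n al v => [|n IH] al v; first by rewrite enum_ord0 det_mx00.
rewrite [in wedges _]enum_ordSl /= wedge_form1 (expand_det_row _ ord0).
apply: eq_bigr => j _; rewrite -map_comp IH /cofactor mxE !mulrA add0n.
congr (_ * _); first exact: mulrC.
by congr (\det _); apply/matrixP => k l; rewrite !mxE.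
Qed.

Lemma map_enum_split {T : Type} p q (f : 'I_p -> T) (g : 'I_q -> T) :
  [seq f i | i <- enum 'I_p] ++ [seq g j | j <- enum 'I_q] =
  [seq match fintype.split k with inl i => f i | inr j => g j end
     | k <- enum 'I_(p + q)].
Proof.
have -> : enum 'I_(p + q) =
    map (@lshift p q) (enum 'I_p) ++ map (@rshift p q) (enum 'I_q).
  apply: (inj_map val_inj); rewrite val_enum_ord map_cat iotaD.
  rewrite add0n -[in iota p q](addn0 p) iotaDl -!val_enum_ord.
  by congr (_ ++ _); rewrite -!map_comp.
rewrite map_cat; congr (_ ++ _); rewrite -map_comp; apply: eq_map => i /=.
  by rewrite (unsplitK (inl i)).
by rewrite (unsplitK (inr i)).
Qed.

Lemma wedges_cat_det p q (al : 'I_p -> V -> R[i]) (be : 'I_q -> V -> R[i])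
    (v : 'I_p -> V) (w : 'I_q -> V) :
  wedges ([seq form1 (al i) | i <- enum 'I_p] ++
          [seq form1 (be i) | i <- enum 'I_q])
    ([seq v j | j <- enum 'I_p] ++ [seq w j | j <- enum 'I_q]) =
  \det (block_mx (\matrix_(i, j) al i (v j)) (\matrix_(i, j) al i (w j))
                 (\matrix_(i, j) be i (v j)) (\matrix_(i, j) be i (w j))).
Proof.
rewrite !map_enum_split.
pose ga k := match fintype.split k with inl i => al i | inr j => be j end.
have -> : [seq match fintype.split k with
                | inl i => form1 (al i) | inr j => form1 (be j)
                end | k <- enum 'I_(p + q)] =
            [seq form1 (ga k) | k <- enum 'I_(p + q)].
  by apply: eq_map => k; rewrite /ga; case: fintype.split.
rewrite wedges_det; congr (\det _); apply/matrixP => k l; rewrite mxE /ga.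
rewrite -[in RHS](splitK k) -[in RHS](splitK l).
case: (fintype.split k) => i; case: (fintype.split l) => j /=;
  by rewrite ?(block_mxEul, block_mxEur, block_mxEdl, block_mxEdr) mxE.
Qed.

End evaluation.

(** * The integrand on the mirror *)

Section pointwise.
Context {R : realType} {m : nat}.
Local Notation C := R[i].
Local Notation pt := 'rV[R]_m.
Local Notation tot := ('rV[R]_m * 'rV[R]_m)%type.

Lemma derive1_affine (x y : R) : derive1 (fun t : R => x + t * y) 0 = y.
Proof.
rewrite derive1E deriveD // derive_cst add0r.
by rewrite deriveM // derive_cst derive_id scaler0 add0r scaler1.
Qed.

Lemma cderive0_affine (x y : C) : cderive0 (fun t : R => x + t%:C * y) = y.
Proof.
case: x y => [x1 x2] [y1 y2]; rewrite /cderive0 /=.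
congr Complex.
  rewrite -[RHS](derive1_affine x1); congr (derive1 _ 0).
  by apply/funext => t /=; rewrite mul0r subr0.
rewrite -[RHS](derive1_affine x2); congr (derive1 _ 0).
by apply/funext => t /=; rewrite mul0r addr0.
Qed.

Lemma univ_curvature_vertical (a : oneform) (b c : oneform) (p : tot) :
  (forall q, a q 0 = 0) -> b p 0 = 0 -> c p 0 = 0 ->
  univ_curvature (a, p) (b, 0) (c, 0) = 0 :> C.
Proof.
move=> a0 b0 c0; rewrite /univ_curvature /univ_connection /move /=.
have -> : (fun t : R => a (p + t *: 0) 0 + t%:C * b (p + t *: 0) 0) =
          fun t => 0 + t%:C * 0.
  by apply/funext => t; rewrite scaler0 addr0 a0 b0.
have -> : (fun t : R => a (p + t *: 0) 0 + t%:C * c (p + t *: 0) 0) =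
          fun t => 0 + t%:C * 0.
  by apply/funext => t; rewrite scaler0 addr0 a0 c0.
by rewrite subrr.
Qed.

Lemma univ_curvature_mixed (a b : oneform) (p v : tot) :
  (forall q, a q 0 = 0) ->
  univ_curvature (a, p) (b, 0) (fun _ _ => 0, v) = b p v :> C.
Proof.
move=> a0; rewrite /univ_curvature /univ_connection /move /=.
have -> : (fun t : R => a (p + t *: 0) v + t%:C * b (p + t *: 0) v) =
          fun t => a p v + t%:C * b p v.
  by apply/funext => t; rewrite scaler0 addr0.
have -> : (fun t : R => a (p + t *: v) 0 + t%:C * 0) = fun t => 0 + t%:C * 0.
  by apply/funext => t; rewrite a0.
by rewrite !cderive0_affine subr0.
Qed.

Variable phi : pt -> R.

Lemma dzt0 j p : dzt phi j p 0 = 0.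
Proof. by rewrite /dzt /dxt /dyt /= linear0 mxE. Qed.

Lemma fourier_mukai0 e f p : fourier_mukai phi e f p 0 = 0.
Proof.
rewrite /fourier_mukai big1 ?mulr0 // => j _.
by rewrite /dxt /dyt /= linear0 mxE !mulr0 addr0.
Qed.

(** The curvature of the connection a on W drops out, all the factors of F^m
    being used up by the b_l. *)
Lemma B_integrand_wedges (a : oneform) (b : 'I_m -> oneform) (p : tot) :
  (forall q, a q 0 = 0) -> (forall l, b l p 0 = 0) ->
  B_integrand phi a b p = (-1) ^+ (m * m + 'C(m, 2)) * m`!%:R *
    wedges ([seq form1 (dzt phi j p) | j <- enum 'I_m] ++
            [seq form1 (b l p) | l <- enum 'I_m])
      ([seq (basis_vec j, 0) | j <- enum 'I_m] ++
       [seq (0, basis_vec j) | j <- enum 'I_m]).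
Proof.
move=> a0 b0; rewrite /B_integrand /Omegat pullback_wedges1.
have sm : size (enum 'I_m) = m := size_enum_ord m.
set F := univ_curvature _.
have -> : wedge_pow (form2 F) m = wedge_pow (form2 F) (size (enum 'I_m)).
  by rewrite sm.
rewrite (@wedge_wedge_pow_cat _ _ _ _ _ _ m) ?sm.
- congr (_ * _).
  (* All the remaining vectors are tangent to W. *)
  pose h (v : tot) : @oneform R m * tot := (fun _ _ => 0, v).
  have := pullback_wedge h
    (wedges [seq form1 (fun v => dzt phi j p v.2) | j <- enum 'I_m])
    (wedges [seq form1 (F (b l, 0)) | l <- enum 'I_m]).
  rewrite !pullback_wedges1 -[in RHS]wedges_cat.
  have -> : [seq form1 (fun v => F (b i, 0) (h v)) | i <- enum 'I_m] =
            [seq form1 (b l p) | l <- enum 'I_m].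
    apply: eq_map => l; congr form1; apply/funext => v.
    exact: univ_curvature_mixed.
  move/(congr1 (fun w => w ([seq (basis_vec j, 0) | j <- enum 'I_m] ++
       [seq (0, basis_vec j) | j <- enum 'I_m]))).
  by rewrite wedges_cat /pullback map_cat -!(map_comp h).
- by move=> i j; apply: univ_curvature_vertical.
- by move=> i; apply: contract_wedges1_eq0 => j; exact: dzt0.
- by rewrite grade_sign_wedges1 sm.
Qed.

Lemma posdef_unitmx (H : 'M[R]_m) : posdef H -> H \in unitmx.
Proof.
move=> Hpos; rewrite -row_free_unit -kermx_eq0; apply/eqP/row_matrixP => i.
rewrite row0; apply/eqP; apply: contraTT isT => v0.
by have := Hpos _ v0; rewrite -row_mul mulmx_ker row0 mul0mx mxE ltxx.
Qed.

Variable x : pt.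
Hypothesis phi_unit : hessian phi x \in unitmx.
Hypothesis phi_diff : forall j, differentiable (xt phi j) x.

Lemma xt_differential v :
  \row_j 'd (xt phi j) x v = v *m hessian phi x.
Proof.
apply/rowP => j; rewrite !mxE {1}(row_sum_delta v) linear_sum /=.
apply: eq_bigr => k _; rewrite linearZ /= mxE /partial deriveE //.
exact: phi_diff.
Qed.

(** Chain rule d g = sum_j (d g / d xt_j) d xt_j. *)
Lemma differential_xt (g : pt -> R) v : differentiable g x ->
  'd g x v = \sum_j partial_xt phi j g x * 'd (xt phi j) x v.
Proof.
move=> gx; rewrite -{1}(mulmxK phi_unit v) -xt_differential mulmx_sum_row.
rewrite linear_sum; apply: eq_bigr => j _.
by rewrite linearZ /= mxE mulrC /partial_xt deriveE.
Qed.

Lemma B_integrandE (e f : pt -> R) (eta mu : 'I_m -> pt -> R) yt :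
    (forall l, differentiable (eta l) x) ->
    (forall l, differentiable (mu l) x) ->
  B_integrand phi (fourier_mukai phi e f)
    (fun l => fourier_mukai phi (eta l) (mu l)) (x, yt) =
  (-1) ^+ (m * m + 'C(m, 2)) * m`!%:R *
    A_integrand (fun l => A_variation (eta l) (mu l)) x.
Proof.
move=> deta dmu; rewrite B_integrand_wedges; first last.
- by move=> l; exact: fourier_mukai0.
- by move=> q; exact: fourier_mukai0.
congr (_ * _); rewrite wedges_cat_det /A_integrand wedges_det.
pose A : 'M[C]_m := \matrix_(j, k) ('d (xt phi j) x (basis_vec k))%:C.
pose N : 'M[C]_m := \matrix_(l, j) (partial_xt phi j (eta l) x)%:C.
pose M : 'M[C]_m := \matrix_(l, j) (partial_xt phi j (mu l) x)%:C.
transitivity (\det (block_mx A 'i%C%:M ('i%C *: (N *m A)) ('i%C *: M))).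
  congr (\det (block_mx _ _ _ _)); apply/matrixP => j k; rewrite !mxE.
  - by rewrite /dzt /dxt /dyt /= mxE.
  - rewrite /dzt /dxt /dyt /= linear0 /basis_vec mxE eqxx /= eq_sym.
    by case: eqP => _; apply/eqP; rewrite eq_complex /= ?eqxx.
  - rewrite /fourier_mukai /=; congr (_ * _).
    apply: eq_bigr => i _.
    by rewrite /dxt /dyt /= !mxE mulr0 addr0 rmorphM.
  rewrite /fourier_mukai /= (bigD1 k) //= big1 => [|i ik].
    by rewrite /dxt /dyt /= linear0 !mxE !eqxx mulr0 add0r addr0 mulr1.
  by rewrite /dxt /dyt /= linear0 !mxE eqxx (negPf ik) !mulr0 addr0.
rewrite det_block_i; last by rewrite -expr2 sqr_i.
congr (\det _); apply/matrixP => l k.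
rewrite !mxE /A_variation !differential_xt //.
apply/eqP; rewrite eq_complex !raddf_sum /=.
apply/andP; split; apply/eqP; apply: eq_bigr => j _; rewrite !mxE /=; ring.
Qed.

End pointwise.

(** * Integration along the fibre *)

Section product_integral.
Context {R : realType} {d1 d2 : measure_display}.
Context {T1 : measurableType d1} {T2 : measurableType d2}.
Variable mu : {sigma_finite_measure set T1 -> \bar R}.
Variable nu : {sigma_finite_measure set T2 -> \bar R}.
Variables (A : set T1) (F : set T2) (v : R).
Hypotheses (mA : measurable A) (mF : measurable F) (nuF : nu F = v%:E).

Lemma Rintegral_prod_fst (h : T1 -> R) (f : T1 * T2 -> R) :
    mu.-integrable A (EFin \o h) ->
    (mu \x nu)%E.-integrable (A `*` F) (EFin \o f) ->
    (forall x y, A x -> F y -> f (x, y) = h x) ->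
  Rintegral (mu \x nu)%E (A `*` F) f = v * Rintegral mu A h.
Proof.
move=> ih iff fh; rewrite /Rintegral integral_mkcond.
have mAF : measurable (A `*` F) by exact: measurableX.
rewrite -integral12_prod_meas1; last exact/(integrable_mkcond _ mAF).
have -> : fubini_F nu ((EFin \o f) \_ (A `*` F)) =
          fun x => (v%:E * ((EFin \o h) \_ A) x)%E.
  apply/funext => x; rewrite /fubini_F; have [Ax|nAx] := pselect (A x).
    rewrite patchT ?inE //= muleC -nuF -(integral_cst nu mF).
    rewrite [RHS]integral_mkcond; apply: eq_integral => y _.
    rewrite !patchE; have [Fy|nFy] := pselect (F y).
      by rewrite !mem_set //= fh.
    by rewrite !memNset //=; case.
  rewrite [in RHS]patchE memNset // -[point]/(0%E) mule0.
  by apply: integral0_eq => y _; rewrite patchE memNset //=; case.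
rewrite integralZl //; last exact/(integrable_mkcond _ mA).
rewrite -integral_mkcond fineM //.
exact: integrable_fin_num.
Qed.

Lemma cintegral_prod_fst (k : R) (h : T1 -> R[i]) (f : T1 * T2 -> R[i]) :
    cintegrable mu A h -> cintegrable (mu \x nu)%E (A `*` F) f ->
    (forall x y, A x -> F y -> f (x, y) = k%:C * h x) ->
  cintegral (mu \x nu)%E (A `*` F) f = (v * k)%:C * cintegral mu A h.
Proof.
move=> [hR hI] [fR fI] fh; rewrite /cintegral.
rewrite (@Rintegral_prod_fst (fun x => k * complex.Re (h x))) //; first last.
- move=> x y Ax Fy; rewrite fh //.
  by case: (h x) => a b /=; rewrite mul0r subr0.
- exact: (integrableZl mA k hR).
rewrite (@Rintegral_prod_fst (fun x => k * complex.Im (h x))) //; first last.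
- move=> x y Ax Fy; rewrite fh //.
  by case: (h x) => a b /=; rewrite mul0r addr0.
- exact: (integrableZl mA k hI).
rewrite !RintegralZl //; apply/eqP; rewrite eq_complex /= !mul0r subr0 addr0.
by rewrite !mulrA !eqxx.
Qed.

End product_integral.

Section volume.
Context {R : realType}.

(** The open cube of centre c and side 2 r. *)
Definition cube n (c : 'I_n -> R) (r : R) : set (n.-tuple R) :=
  [set t | forall i, `|tnth t i - c i| < r].

Lemma measurable_cube n (c : 'I_n -> R) r : measurable (cube n c r).
Proof.
have -> : cube n c r = \bigcap_(i in [set: 'I_n])
    ((@tnth n R)^~ i @^-1` (ball (c i) r)).
  apply/seteqP; split => t /= ct i.
    by move=> _; rewrite /= /ball /= distrC.
  by have := ct i I; rewrite /= /ball /= distrC.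
apply: fin_bigcap_measurable => // i _; rewrite -[X in measurable X]setTI.
by apply: measurable_tnth => //; exact: measurable_ball.
Qed.

Lemma lebesgue_tuple_cube n (c : 'I_n -> R) r : 0 <= r ->
  lebesgue_tuple (cube n c r) = ((r *+ 2) ^+ n)%:E.
Proof.
move=> r0; elim: n c => [|n IH] c.
  by rewrite /= diracE mem_set // => -[].
rewrite /= /pushforward.
have -> : (@cons_pair R n) @^-1` cube n.+1 c r =
    ball (c ord0) r `*` cube n (fun i => c (lift ord0 i)) r.
  apply/seteqP; split => -[x t] /=.
    move=> xt; split=> [|i]; first by rewrite /ball /= distrC; apply: (xt ord0).
    by have := xt (lift ord0 i); rewrite tnthS.
  rewrite /ball /= => -[cx ct] i.
  have [->|[j ->]] : i = ord0 \/ exists j, i = lift ord0 j.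
    by case: (unliftP ord0 i) => [j ->|->]; [right; exists j|left].
  - by rewrite distrC.
  by rewrite tnthS; exact: ct.
rewrite product_measure1E; [|exact: measurable_ball|exact: measurable_cube].
rewrite [X in (_ * X)%E = _]IH [X in (X * _)%E = _]lebesgue_measure_ball //.
by rewrite -EFinM -exprS.
Qed.

Context {m : nat}.
Local Notation pt := 'rV[R]_m.

Lemma measurable_row_of (j : 'I_m) :
  measurable_fun setT (fun t : m.-tuple R => row_of t 0 j).
Proof.
rewrite (_ : (fun _ => _) = (@tnth m R)^~ j); first exact: measurable_tnth.
by apply/funext => t; rewrite mxE.
Qed.

Lemma measurable_row_of_mulmx (G : 'M[R]_m) (j : 'I_m) :
  measurable_fun setT (fun t : m.-tuple R => (row_of t *m G) 0 j).
Proof.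
under eq_fun do rewrite mxE.
apply: measurable_sum => i; apply: measurable_funM => //.
exact: measurable_row_of.
Qed.

Lemma measurable_A_domain (B : set pt) : open_ball B -> measurable (A_domain B).
Proof.
case=> a [r [r0 ->]]; rewrite /A_domain.
pose f (t : m.-tuple R) := \sum_j (row_of t 0 j - a 0 j) ^+ 2.
have mf : measurable_fun setT f.
  apply: measurable_sum => j; apply: measurable_funX.
  by apply: measurable_funB => //; exact: measurable_row_of.
rewrite (_ : _ @^-1` _ = setT `&` f @^-1` `]-oo, (r ^+ 2)[); first exact: mf.
by apply/seteqP; split => t /=; rewrite ?in_itv /f //= => -[].
Qed.

(** The basis underlying [fundamental_domain]: a chosen basis of L, or the
    identity matrix when L is not a lattice; it is invertible in both cases. *)
Definition fundamental_basis (L : set pt) : 'M[R]_m :=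
  xget 1%:M [set G | lattice_basis L G].

Lemma fundamental_basis_unit L : fundamental_basis L \in unitmx.
Proof.
rewrite /fundamental_basis; case: xgetP => [G _ []//|_]; exact: unitmx1.
Qed.

Lemma fundamental_domainE L (x : pt) :
  fundamental_domain L x <->
  forall j, 0 <= (x *m invmx (fundamental_basis L)) 0 j < 1.
Proof.
have Gu := fundamental_basis_unit L; split.
  by move=> [t t01 <-] j; rewrite mulmxK.
by move=> x01; exists (x *m invmx (fundamental_basis L)) => //; rewrite mulmxKV.
Qed.

Lemma measurable_fundamental_domain L :
  measurable (row_of @^-1` fundamental_domain L : set (m.-tuple R)).
Proof.
rewrite (_ : _ @^-1` _ = \bigcap_(j in [set: 'I_m]) (setT `&`
  (fun t => (row_of t *m invmx (fundamental_basis L)) 0 j) @^-1` `[0, 1[)).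
  apply: fin_bigcap_measurable => // j _.
  by apply: measurable_row_of_mulmx => //; exact: measurable_itv.
apply/seteqP; split => t /=.
  by move/fundamental_domainE => t01 j _; split => //=; rewrite in_itv /=.
move=> t01; apply/fundamental_domainE => j.
by have [_] := t01 j I; rewrite /= in_itv.
Qed.

Lemma le_norm_mulmx (x : pt) (G : 'M[R]_m) r (j : 'I_m) :
  (forall i, `|x 0 i| <= r) ->
  `|(x *m G) 0 j| <= r * \sum_i \sum_k `|G i k|.
Proof.
move=> xr; rewrite mxE; apply: le_trans (ler_norm_sum _ _ _) _.
rewrite mulr_sumr; apply: ler_sum => i _.
rewrite normrM; apply: ler_pM => //.
by rewrite (bigD1 j) //= lerDl sumr_ge0.
Qed.

(** A fundamental parallelotope has positive and finite volume. *)
Lemma lebesgue_fundamental_domain L : exists v : R, 0 < v /\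
  @lebesgue_tuple R m (row_of @^-1` fundamental_domain L) = v%:E.
Proof.
set D := row_of @^-1` _.
have mD : measurable D := measurable_fundamental_domain L.
set G := fundamental_basis L.
have sum_ge0 (H : 'M[R]_m) : 0 <= \sum_i \sum_k `|H i k|.
  by apply: sumr_ge0 => i _; apply: sumr_ge0.
pose r := 1 + \sum_i \sum_k `|G i k|.
pose s := (2 * (1 + \sum_i \sum_k `|invmx G i k|))^-1.
have s0 : 0 < s by rewrite invr_gt0 mulr_gt0 // ltr_pwDl.
(* The parallelotope is centred at c. *)
pose c : pt := const_mx 2^-1 *m G.
have Dr : D `<=` cube m (fun=> 0) r.
  move=> t /= [u u01 ut] i; rewrite subr0.
  have -> : tnth t i = row_of t 0 i by rewrite mxE.
  rewrite -ut -/G; apply: le_lt_trans (le_norm_mulmx u G 1 i _) _.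
    by move=> j; have /andP[u0 u1] := u01 j; rewrite ger0_norm // ltW.
  by rewrite mul1r ltrDr.
have sD : cube m (c 0) s `<=` D.
  move=> t ct; apply/fundamental_domainE => j; rewrite -/G.
  set y := (row_of t *m _) 0 j.
  have yE : ((row_of t - c) *m invmx G) 0 j = y - 2^-1.
    rewrite mulmxBl /c mulmxK ?fundamental_basis_unit // mxE; congr (_ + _).
    by rewrite 2!mxE.
  have : `|y - 2^-1| < 2^-1.
    rewrite -yE; apply: le_lt_trans (le_norm_mulmx _ _ s _ _) _.
      by move=> i; rewrite !mxE; have := ct i; rewrite /c mxE => /ltW.
    rewrite /s invfM -mulrA gtr_pMr ?invr_gt0 // mulrC ltr_pdivrMr ?mul1r.
      by rewrite ltrDr.
    by rewrite ltr_pwDl.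
  by rewrite ltr_norml; lra.
have r0 : 0 <= r by rewrite addr_ge0.
have Dfin : lebesgue_tuple D \is a fin_num.
  rewrite ge0_fin_numE //.
  have := le_measure (@lebesgue_tuple R m) (mem_set mD)
    (mem_set (measurable_cube _ (fun=> 0) r)) Dr.
  by move/le_lt_trans; apply; rewrite [ltLHS]lebesgue_tuple_cube // ltry.
exists (fine (lebesgue_tuple D)); rewrite fineK //; split => //.
rewrite -lte_fin fineK //.
have := le_measure (@lebesgue_tuple R m)
  (mem_set (measurable_cube _ (c 0) s)) (mem_set mD) sD.
apply: lt_le_trans.
by rewrite [ltRHS]lebesgue_tuple_cube ?ltW // lte_fin exprn_gt0 // mulrn_wgt0.
Qed.

End volume.

(** * Proportionality of the two forms *)

Theorem mainTheorem3 (R : realType) (m : nat) (Lambda : set 'rV[R]_m)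
    (hLambda : is_lattice Lambda) (orC orW : bool) :
  exists c : R[i], c != 0 /\
    forall (B : set 'rV[R]_m) (phi : 'rV[R]_m -> R) (e f : 'rV[R]_m -> R)
      (eta mu : 'I_m -> 'rV[R]_m -> R),
    semi_flat B phi ->
    smooth_on B e -> smooth_on B f ->
    special_lagrangian B phi (grad_section phi f) ->
    (forall l, smooth_on B (eta l) /\ smooth_on B (mu l)) ->
    (forall l, harmonic_form B phi (grad_section phi f)
                 (A_variation (eta l) (mu l))) ->
    A_convergent B (fun l => A_variation (eta l) (mu l)) ->
    B_convergent B phi (dual_lattice Lambda) (fourier_mukai phi e f)
      (fun l => fourier_mukai phi (eta l) (mu l)) ->
    B_Omega B phi orW (dual_lattice Lambda) (fourier_mukai phi e f)
      (fun l => fourier_mukai phi (eta l) (mu l)) =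
    c * A_Omega B orC (fun l => A_variation (eta l) (mu l)).
Proof.
have [v [v0 vE]] := lebesgue_fundamental_domain (dual_lattice Lambda).
pose k : R := (-1) ^+ (m * m + 'C(m, 2)) * m`!%:R.
have k0 : k != 0 by rewrite mulf_neq0 ?signr_eq0 // pnatr_eq0 -lt0n fact_gt0.
exists ((-1) ^+ orW * (v * k)%:C * (-1) ^+ orC); split.
  by rewrite !mulf_neq0 ?signr_eq0 // fmorph_eq0 mulf_neq0 // gt_eqF.
move=> B phi e f eta mu [Bball phi_smooth phi_pos _] _ _ _ em_smooth _ cvA cvB.
rewrite /B_Omega /A_Omega -3!mulrA signrMK; congr (_ * _).
apply: (cintegral_prod_fst _ _ _ _ _ _ _ vE k _ _ cvA cvB).
- exact: measurable_A_domain.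
- exact: measurable_fundamental_domain.
move=> x y Bx _; rewrite /= B_integrandE.
- by rewrite rmorphM rmorphXn rmorphN1 rmorph_nat.
- exact/posdef_unitmx/phi_pos.
- by move=> j; exact: (phi_smooth [:: j]).
- by move=> l; exact: ((em_smooth l).1 [::]).
- by move=> l; exact: ((em_smooth l).2 [::]).
Qed.
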